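(* Fix a positive integer $d$ and a tuple of non-negative integers $\mathbf{w}=(w_0,\dots,w_{d-1})$ with $w_{d-1}\ge 1$. Let $\tilde c_{\mathbf{w}}$ be the largest positive root of the polynomial $$\widetilde P_{\mathbf{w}}(x)=(x-1)\sum_{j=0}^{d-1} w_j x^j - x^{d-1}.$$ Then for every $C\in(1,\infty)$ there exists a strictly increasing sequence of positive integers $\{a_n\}_{n=1}^\infty$ satisfying $\lim_{n\to\infty} a_n^{1/\tilde c_{\mathbf{w}}^n}=C$ and $$\sum_{n=1}^\infty \frac{1}{a_n^{w_0}a_{n+1}^{w_1}\cdots a_{n+d-1}^{w_{d-1}}}\in\mathbb{Q}.$$
   Context: The largest real root of $\widetilde P_{\mathbf{w}}$ lies in $(1,\infty)$ since $\widetilde P_{\mathbf{w}}(1)<0$. *)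

(* Defs.v *)
From HB Require Import structures.
From mathcomp Require Import all_boot all_order all_algebra.
From mathcomp Require Import all_classical all_reals all_analysis.
From mathcomp Require polyrcf.
Set Implicit Arguments.
Unset Strict Implicit.
Unset Printing Implicit Defensive.
Import Order.TTheory GRing.Theory Num.Theory.
Import numFieldNormedType.Exports.
Local Open Scope classical_set_scope.
Local Open Scope ring_scope.

Definition Ptilde (R : realType) (d : nat) (w : d.-tuple nat) : {poly R} :=
  ('X - 1) * (\sum_(j < d) (tnth w j)%:R *: 'X^j) - 'X^(d.-1).

Definition is_largest_positive_root (R : realType) (p : {poly R}) (c : R) :=
  [/\ root p c, 0 < c & forall x : R, root p x -> 0 < x -> x <= c].

(* 1 / (a_n ^ w_0 * a_(n+1) ^ w_1 * ... * a_(n+d-1) ^ w_(d-1)) *)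
Definition weighted_term (R : realType) (d : nat) (w : d.-tuple nat)
    (a : nat -> nat) (n : nat) : R :=
  1 / (\prod_(j < d) a (n + j)%N ^ tnth w j)%N%:R.

Lemma Ptilde_largest_positive_root_exists (R : realType) (d : nat)
    (w : d.-tuple nat) :
  (0 < d)%N -> (1 <= nth 0%N w d.-1)%N ->
  exists2 c : R, is_largest_positive_root (Ptilde R w) c & 1 < c.
Proof.
move=> d0 wd.
have hP (x : R) : (Ptilde R w).[x] =
    (x - 1) * (\sum_(j < d) (tnth w j)%:R * x ^+ j) - x ^+ d.-1.
  rewrite /Ptilde !hornerE horner_sum; congr (_ * _ - _).
  by apply: eq_bigr => j _; rewrite !hornerE.
have P1 : (Ptilde R w).[1] = -1 by rewrite hP subrr mul0r sub0r expr1n.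
have P2 : 0 <= (Ptilde R w).[2].
  rewrite hP (_ : 2 - 1 = 1 :> R) ?mul1r ?subr_ge0; last first.
    by apply/eqP; rewrite subr_eq.
  have dd : (d.-1 < d)%N by rewrite prednK.
  rewrite (bigD1 (Ordinal dd)) //= -[leLHS]addr0 lerD //; last first.
    by apply: sumr_ge0 => j _; rewrite mulr_ge0 // exprn_ge0.
  rewrite ler_peMl ?exprn_ge0 //.
  by rewrite (tnth_nth 0%N) /= (ler_nat R 1).
have [|x0 /andP[x01 _] rx0] :=
    @Num.Theory.poly_ivt R (Ptilde R w) 1 2 (ler1n R 2).
  by rewrite P1 P2 lerN10.
have Pn0 : Ptilde R w != 0.
  by apply/eqP => P0; move/eqP: P1; rewrite P0 horner0 eq_sym oppr_eq0 oner_eq0.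
have rP := polyrcf.roots_on_rootsR Pn0.
have x0s : x0 \in polyrcf.rootsR (Ptilde R w) by rewrite -rP rx0 in_itv.
pose c := \big[Num.max/x0]_(x <- polyrcf.rootsR (Ptilde R w)) x.
have c1 : x0 <= c by apply: le_bigmax_seq x0s _.
have rc : root (Ptilde R w) c.
  rewrite /c big_seq; elim/big_ind : _ => //.
    by move=> x y hx hy; rewrite /Num.max; case: ifP.
  by move=> x; rewrite -rP => /andP[].
have cn1 : c != 1.
  by apply/eqP => ce; move: rc; rewrite ce rootE P1 oppr_eq0 oner_eq0.
have c_gt1 : 1 < c by rewrite lt_neqAle eq_sym cn1 (le_trans x01).
exists c => //; split => //; first exact: lt_trans c_gt1.
by move=> x rx _; apply: le_bigmax_seq => //; rewrite -rP rx in_itv.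
Qed.

(* Main.v *)
(** Let [A k] be close to [L * 8 ^ k * C ^ (c ^ k)] with [L] a large constant,
    and let [a k] range over the integers of the window [[A k, 2 * A k]]: every
    such sequence is strictly increasing and has the required growth, so it
    suffices to show that the sums attained contain an interval. Raising [a m]
    by one lowers the sum by about [T n / a m], where [T n] is the first term
    containing [a m], whereas the freedom left in [a (m + 1)] moves the sum by
    about [T (n + 1)]. The equation [P(c) = 0] makes these two quantities
    comparable up to a constant, and a large [L] makes the second one dominate.
    Hence a greedy choice of [a 0], [a 1], ... reaches every real number between
    the sums of [2 * A] and of [A], in particular a rational one. *)

Require Import Defs.
From HB Require Import structures.
From mathcomp Require Import all_boot all_order all_algebra.
From mathcomp Require Import all_classical all_reals all_analysis.
From mathcomp Require Import ring lra zify.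
Import Order.TTheory GRing.Theory Num.Theory.
Import numFieldNormedType.Exports.
Local Open Scope classical_set_scope.
Local Open Scope ring_scope.

(** * Denominators under a change of entries *)

Definition denom {d : nat} (w : d.-tuple nat) (a : nat -> nat) (n : nat) : nat :=
  (\prod_(j < d) a (n + j) ^ tnth w j)%N.

Definition weight {d : nat} (w : d.-tuple nat) : nat :=
  (\sum_(j < d) tnth w j)%N.

Lemma weighted_termE (R : realType) {d : nat} (w : d.-tuple nat) a n :
  weighted_term R w a n = (denom w a n)%:R^-1.
Proof. by rewrite /weighted_term div1r. Qed.

Lemma denom_gt0 {d : nat} (w : d.-tuple nat) a n :
  (forall k, 0 < a k)%N -> (0 < denom w a n)%N.
Proof. by move=> a0; apply: prodn_gt0 => j; rewrite expn_gt0 a0. Qed.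

Lemma leq_expn_mul (s x y m k : nat) :
  (s * y <= m * x)%N -> (s ^ k * y ^ k <= m ^ k * x ^ k)%N.
Proof. by move=> h; case: k => // k; rewrite -!expnMn leq_exp2r. Qed.

(** Homogeneity of degree [weight w]; the ratio [m / s] is kept in cleared form so as to stay within
    the naturals. *)
Lemma denom_scale {d : nat} (w : d.-tuple nat) x y (s m n : nat) :
  (forall k, s * y k <= m * x k)%N ->
  (s ^ weight w * denom w y n <= m ^ weight w * denom w x n)%N.
Proof.
move=> h; rewrite /weight /denom !expn_sum -!big_split /=.
by apply: leq_prod => j _; apply: leq_expn_mul.
Qed.

(** The last exponent is positive, so one copy of the last entry can supply the factor 2, while all
    other copies use the ratio [m / s]. *)
Lemma denom_scale_last {e : nat} (w : e.+1.-tuple nat) x y (s m n : nat) :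
  (0 < tnth w ord_max)%N -> (s <= m)%N ->
  (forall k, s * y k <= m * x k)%N -> (2 * y (n + e) <= x (n + e))%N ->
  (2 * (s ^ weight w * denom w y n) <= m ^ weight w * denom w x n)%N.
Proof.
move=> w0 sm h h2; rewrite /weight /denom !expn_sum -!big_split /=.
rewrite !big_ord_recr /= mulnA [(2 * _)%N]mulnC -mulnA.
apply: leq_mul; first by apply: leq_prod => j _; apply: leq_expn_mul.
have [k ->] : exists k, tnth w ord_max = k.+1 by case: (tnth _ _) w0 => // k; exists k.
rewrite !expnS; set p := (s ^ k)%N; set q := (y (n + e) ^ k)%N.
have := @leq_expn_mul _ _ _ _ k (h (n + e)%N); rewrite -/p -/q.
set p' := (m ^ k)%N; set q' := (x (n + e) ^ k)%N => hk.
rewrite (_ : (_ * _)%N = (s * (2 * y (n + e)) * (p * q))%N); last by ring.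
rewrite (_ : (m * p' * _)%N = (m * x (n + e)%N * (p' * q'))%N); last by ring.
by apply: leq_mul hk; apply: leq_mul.
Qed.

(** Bernoulli's inequality [(1 + 1/t)^k * (1 - k/t) <= 1] cleared of denominators; truncated
    subtraction makes it trivial for [k >= t]. *)
Lemma bernoulli_subn (t k : nat) : (t.+1 ^ k * (t - k) <= t ^ k * t)%N.
Proof.
elim: k => [|k IH]; first by rewrite subn0.
apply: (@leq_trans (t.+1 ^ k * (t - k) * t)); last first.
  by rewrite expnS [(t * _)%N]mulnC leq_mul2r IH orbT.
rewrite expnS [(t.+1 * _)%N]mulnC -!mulnA leq_mul2l; apply/orP; right.
by nia.
Qed.

(* Passing from [t] to [t + 1] in one place costs at most a factor
   [1 + W / (t - W)], and halving the last entry outweighs it. *)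
Lemma denom_bump {d : nat} (w : d.-tuple nat) x y (t n : nat) :
  (0 < t)%N -> (forall k, t * y k <= t.+1 * x k)%N ->
  ((t - weight w) * denom w y n <= t * denom w x n)%N.
Proof.
move=> t0 /(@denom_scale _ w x y t t.+1 n) h.
rewrite -(@leq_pmul2l (t ^ weight w)) ?expn_gt0 ?t0 // mulnCA.
apply: (leq_trans (leq_mul (leqnn _) h)).
by rewrite !mulnA leq_mul2r [(_ * t.+1 ^ _)%N]mulnC bernoulli_subn orbT.
Qed.

(** For [t >= 4 * weight w] the loss factor [1 - weight w / t] is at least 3/4, so the gain 2 leaves
    3/2. *)
Lemma denom_bump_last {e : nat} (w : e.+1.-tuple nat) x y (t n : nat) :
  (0 < tnth w ord_max)%N -> (0 < t)%N -> (4 * weight w <= t)%N ->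
  (forall k, t * y k <= t.+1 * x k)%N -> (2 * y (n + e) <= x (n + e))%N ->
  (3 * denom w y n <= 2 * denom w x n)%N.
Proof.
move=> w0 t0 tW h h2.
have {}h := denom_scale_last w x y t t.+1 n w0 (leqnSn t) h h2.
have hb := bernoulli_subn t (weight w).
have {h}hb : (2 * (t - weight w) * denom w y n <= t * denom w x n)%N.
  rewrite -(@leq_pmul2l (t ^ weight w)) ?expn_gt0 ?t0 //.
  rewrite (_ : (_ * _)%N =
    ((t - weight w) * (2 * (t ^ weight w * denom w y n)))%N); last by ring.
  apply: (leq_trans (leq_mul (leqnn _) h)).
  by rewrite !mulnA leq_mul2r [(_ * t.+1 ^ _)%N]mulnC hb orbT.
rewrite -(@leq_pmul2l t) //.
have : (3 * t <= 4 * (t - weight w))%N by lia.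
move=> /(leq_mul (leqnn (denom w y n))). lia.
Qed.

(** * Finite and infinite sums when one digit is raised *)

Definition partial_sum (R : realType) {d : nat} (w : d.-tuple nat)
    (a : nat -> nat) (N : nat) : R :=
  \sum_(n < N) weighted_term R w a n.

Lemma partial_sumS (R : realType) {d : nat} (w : d.-tuple nat) a N :
  partial_sum R w a N.+1 = partial_sum R w a N + weighted_term R w a N.
Proof. exact: big_ord_recr. Qed.

(** Terms with [n + e < m] do not change, and those with [n + e > m] gain a factor 3/2. Only the
    term with [n + e = m] can drop, and [ratio] bounds the drop by half of the next term of [b],
    which is what that next term gains. The excluded [N] is the one that cuts the sum between these
    two terms. *)
Lemma partial_sum_bump (R : realType) {e : nat} (w : e.+1.-tuple nat)
    (b b' : nat -> nat) (m N : nat) :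
  (0 < tnth w ord_max)%N ->
  (forall k, 0 < b' k)%N ->
  (forall k, k < m -> b k = b' k)%N ->
  (b' m = (b m).+1)%N -> (0 < b m)%N -> (4 * weight w <= b m)%N ->
  (forall k, m < k -> b k = 2 * b' k)%N ->
  (forall n, 2 * weight w * denom w b n.+1 <= b (n + e) * denom w b n)%N ->
  (N + e != m.+1)%N ->
  partial_sum R w b N <= partial_sum R w b' N.
Proof.
move=> w0 b'0 blt beq bm0 bmW bgt ratio.
have bm k : (b m * b' k <= (b m).+1 * b k)%N.
  have [km|km|->] := ltngtP k m; last by rewrite beq mulnC.
    by rewrite (blt _ km) leq_mul2r leqnSn orbT.
  by rewrite (bgt _ km); lia.
have b0 k : (0 < b k)%N.
  have [km|km|->] := ltngtP k m; [by rewrite blt | by rewrite bgt ?muln_gt0 ?b'0 | exact: bm0].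
have D0 n : 0 < (denom w b n)%:R :> R by rewrite ltr0n; apply: denom_gt0.
have D'0 n : 0 < (denom w b' n)%:R :> R by rewrite ltr0n denom_gt0.
have t0 : 0 < (b m)%:R :> R by rewrite ltr0n.
have Tlt n : (n + e < m)%N -> weighted_term R w b n = weighted_term R w b' n.
  move=> nm; rewrite !weighted_termE; congr (_%:R^-1); apply: eq_bigr => j _.
  rewrite blt // (leq_ltn_trans _ nm) // leq_add2l -ltnS; exact: ltn_ord.
have Tgt n : (m < n + e)%N ->
    weighted_term R w b n * (3 / 2) <= weighted_term R w b' n.
  move=> nm; rewrite !weighted_termE.
  have /(_ (eq_leq (esym (bgt _ nm)))) :=
    @denom_bump_last e w b b' (b m) n w0 bm0 bmW bm.
  rewrite -(ler_nat R) !natrM => h.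
  rewrite -[leRHS]mulr1 ler_pdivlMl // mulrCA ler_pdivrMl // mulr1.
  by move: h; lra.
have Tge n : (m < n + e)%N -> weighted_term R w b n <= weighted_term R w b' n.
  move=> /Tgt; apply: le_trans; rewrite ler_peMr ?weighted_termE ?invr_ge0 //.
  by lra.
have Teq n : (n + e = m)%N ->
    weighted_term R w b n + weighted_term R w b n.+1 <=
    weighted_term R w b' n + weighted_term R w b' n.+1.
  move=> nm; have /Tgt h1 : (m < n.+1 + e)%N by rewrite addSn nm.
  have /(_ n) := @denom_bump _ w b b' (b m) _ bm0 bm.
  rewrite -(ler_nat R) !natrM natrB; last by lia.
  move: (ratio n) h1; rewrite nm -(ler_nat R) !natrM !weighted_termE.
  set W := (weight w)%:R; set t := (b m)%:R; set D := (denom w b n)%:R.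
  set D' := (denom w b' n)%:R; set E := (denom w b n.+1)%:R.
  set E' := (denom w b' n.+1)%:R => h2 h1 h3.
  have E0 : 0 < E by exact: D0.
  have Dp : 0 < D by exact: D0.
  have D'p : 0 < D' by exact: D'0.
  have h4 : W / (t * D) <= E^-1 / 2.
    rewrite ler_pdivrMr ?mulr_gt0 // -mulrA ler_pdivlMl //.
    by move: h2; lra.
  have h5 : D^-1 - W / (t * D) <= D'^-1.
    have -> : D^-1 - W / (t * D) = (t - W) / (t * D).
      by field; rewrite !gt_eqF.
    by rewrite ler_pdivrMr ?mulr_gt0 // mulrC ler_pdivlMr // mulrC [D' * _]mulrC.
  by lra.
(* Two consecutive lengths are carried along, since the excluded length has to be jumped over. *)
suff : ((N + e != m.+1)%N -> partial_sum R w b N <= partial_sum R w b' N) /\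
       ((N.+1 + e != m.+1)%N -> partial_sum R w b N.+1 <= partial_sum R w b' N.+1).
  by case.
elim: N => [|N [IH1 IH2]].
  split; first by rewrite /partial_sum !big_ord0.
  rewrite /partial_sum !big_ord1 /= add1n eqSS => em.
  have [h|h|h] := ltngtP e m; [by rewrite Tlt | exact: Tge | by rewrite h eqxx in em].
split => // ne; rewrite partial_sumS [leRHS]partial_sumS.
have [h|h|h] := ltngtP (N.+1 + e) m.+1.
- rewrite Tlt ?lerD2r; first by apply: IH2; rewrite (ltn_eqF h).
  by move: ne h; rewrite addSn => /eqP; lia.
- apply: lerD; first by apply: IH2; rewrite (gtn_eqF h).
  by apply: Tge; lia.
- rewrite !partial_sumS -!addrA; apply: lerD; first by apply: IH1; lia.
  by apply: Teq; lia.
Qed.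

(** The terms are nonnegative, so this is the sum of the series as soon as the partial sums are
    bounded; a supremum turns comparisons into upper bounds. *)
Definition total_sum (R : realType) {d : nat} (w : d.-tuple nat)
    (a : nat -> nat) : R := sup (range (partial_sum R w a)).

Lemma weighted_term_ge0 (R : realType) {d : nat} (w : d.-tuple nat) a n :
  0 <= weighted_term R w a n.
Proof. by rewrite weighted_termE invr_ge0. Qed.

Lemma partial_sum_nondecreasing (R : realType) {d : nat} (w : d.-tuple nat) a :
  nondecreasing_seq (partial_sum R w a).
Proof.
by apply/nondecreasing_seqP => n; rewrite partial_sumS lerDl weighted_term_ge0.
Qed.

Lemma weighted_term_le_geometric (R : realType) {e : nat}
    (w : e.+1.-tuple nat) a n :
  (0 < tnth w ord_max)%N -> (forall n, 2 ^ n <= a n)%N ->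
  weighted_term R w a n <= 2^-1 ^+ n.
Proof.
move=> w0 ha; rewrite weighted_termE exprVn lef_pV2 ?posrE ?exprn_gt0 ?ltr0n //;
  last by apply: denom_gt0 => k; rewrite (leq_trans _ (ha k)) ?expn_gt0.
rewrite -natrX ler_nat /denom big_ord_recr /=.
have a0 k : (0 < a k)%N by rewrite (leq_trans _ (ha k)) ?expn_gt0.
rewrite -[leqLHS]mul1n leq_mul //; first by apply: prodn_gt0 => j; rewrite expn_gt0 a0.
apply: (@leq_trans (a (n + e) ^ 1)%N); last exact: leq_pexp2l.
by rewrite expn1 (leq_trans _ (ha _)) // leq_exp2l // leq_addr.
Qed.

Lemma partial_sum_tail (R : realType) {e : nat} (w : e.+1.-tuple nat) a N M :
  (0 < tnth w ord_max)%N -> (forall n, 2 ^ n <= a n)%N ->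
  partial_sum R w a M <= partial_sum R w a N + 2 * 2^-1 ^+ N.
Proof.
move=> w0 ha; have [MN|/ltnW NM] := leqP M N.
  apply: (le_trans (partial_sum_nondecreasing R w a _ _ MN)).
  by rewrite lerDl mulr_ge0 // exprn_ge0.
(* With the remainder added on the left too, the quantity is nonincreasing in [M], which makes the
   induction go through. *)
apply: (@le_trans _ _ (partial_sum R w a M + 2 * 2^-1 ^+ M)).
  by rewrite lerDl mulr_ge0 // exprn_ge0.
rewrite -(subnKC NM); elim: (M - N)%N => [|k IH]; first by rewrite addn0.
apply: le_trans IH; rewrite addnS partial_sumS exprS.
have := weighted_term_le_geometric R w a (N + k) w0 ha; lra.
Qed.

Lemma partial_sum_le_total (R : realType) {e : nat} (w : e.+1.-tuple nat) a N :
  (0 < tnth w ord_max)%N -> (forall n, 2 ^ n <= a n)%N ->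
  partial_sum R w a N <= total_sum R w a.
Proof.
move=> w0 ha; apply: ub_le_sup; last by exists N.
by exists (partial_sum R w a 0 + 2 * 2^-1 ^+ 0) => _ [M _ <-]; apply: partial_sum_tail.
Qed.

Lemma total_le_ub (R : realType) {d : nat} (w : d.-tuple nat) a (z : R) :
  (forall N, partial_sum R w a N <= z) -> total_sum R w a <= z.
Proof.
by move=> h; apply: ge_sup; [exists (partial_sum R w a 0), 0%N | move=> _ [M _ <-]].
Qed.

Lemma total_sum_bump (R : realType) {e : nat} (w : e.+1.-tuple nat)
    (b b' : nat -> nat) (m : nat) :
  (0 < tnth w ord_max)%N ->
  (forall n, 2 ^ n <= b' n)%N ->
  (forall k, k < m -> b k = b' k)%N ->
  (b' m = (b m).+1)%N -> (0 < b m)%N -> (4 * weight w <= b m)%N ->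
  (forall k, m < k -> b k = 2 * b' k)%N ->
  (forall n, 2 * weight w * denom w b n.+1 <= b (n + e) * denom w b n)%N ->
  total_sum R w b <= total_sum R w b'.
Proof.
move=> w0 hb' blt beq bm0 bmW bgt ratio; apply: total_le_ub => N.
(* Lengthening the sum by [m + 2] steps past the excluded length. *)
apply: (le_trans (partial_sum_nondecreasing R w b _ _ (leq_addr m.+2 N))).
apply: le_trans (partial_sum_le_total R w b' (N + m.+2)%N w0 hb').
apply: (@partial_sum_bump R e w b b' m) => // [k|]; last by lia.
by rewrite (leq_trans _ (hb' k)) ?expn_gt0.
Qed.

(** * Greedy choice of the digits *)

Definition splice (m : nat) (f g : nat -> nat) (n : nat) : nat :=
  if (n < m)%N then f n else g n.

Definition update (f : nat -> nat) (m t n : nat) : nat :=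
  if n == m then t else f n.

Definition in_window (A x : nat -> nat) (k : nat) : Prop :=
  (A k <= x k <= 2 * A k)%N.

Lemma splice_updateE m f g t n :
  splice m.+1 (update f m t) g n =
  if (n < m)%N then f n else if n == m then t else g n.
Proof. by rewrite /splice /update ltnS; case: ltngtP. Qed.

Lemma splice_update_id m f g : splice m.+1 (update f m (g m)) g = splice m f g.
Proof.
by apply/funext => n; rewrite splice_updateE /splice; case: ltngtP => // ->.
Qed.

(* [theta] stays reachable: it lies between the totals obtained by completing
   the prefix of length [m] with the largest and with the smallest digits. *)
Definition reachable (R : realType) {d : nat} (w : d.-tuple nat)
    (A : nat -> nat) (theta : R) (m : nat) (f : nat -> nat) : Prop :=
  (forall k, (k < m)%N -> in_window A f k) /\
  total_sum R w (splice m f (fun k => 2 * A k)%N) <= theta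
    <= total_sum R w (splice m f A).

(** The third condition makes each term large enough to repay, with half of itself, the loss in its
    predecessor. It is asked of all window sequences because the greedy digits are not known in
    advance. *)
Definition ample {e : nat} (w : e.+1.-tuple nat) (A : nat -> nat) : Prop :=
  [/\ (forall n, 2 ^ n <= A n)%N, (forall n, 4 * weight w <= A n)%N &
    forall x n, (forall k, in_window A x k) ->
      (2 * weight w * denom w x n.+1 <= x (n + e) * denom w x n)%N].

(** The new digit is the largest [t] whose completion by smallest digits still totals at least
    [theta]. Either [t = 2 * A m] and the lower total is unchanged, or [t + 1] fails, and its
    smallest completion dominates the largest completion of [t]. *)
Lemma reachable_step (R : realType) {e : nat} (w : e.+1.-tuple nat) A
    (theta : R) m f :
  (0 < tnth w ord_max)%N -> ample w A -> reachable R w A theta m f ->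
  exists t, reachable R w A theta m.+1 (update f m t).
Proof.
move=> w0 [A2 AW ratio] [fwin /andP[lo hi]].
pose ok t := (A m <= t <= 2 * A m)%N &&
  (theta <= total_sum R w (splice m.+1 (update f m t) A)).
have okA : ok (A m) by rewrite /ok splice_update_id hi andbT; lia.
have okub t : ok t -> (t <= 2 * A m)%N by move=> /andP[/andP[]].
have win t : (A m <= t <= 2 * A m)%N -> forall k, (k < m.+1)%N ->
    in_window A (update f m t) k.
  move=> ht k; rewrite ltnS /in_window /update.
  by case: ltngtP => // [km|->] _ //; exact: fwin.
have exok : exists t, ok t by exists (A m).
case: (ex_maxnP exok okub) => t /andP[ht tlo] tmax.
exists t; split; first exact: win.
apply/andP; split=> //.
have [tB|tB] := eqVneq t (2 * A m)%N.
  by rewrite tB (splice_update_id m f (fun k => 2 * A k)%N).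
have t1 : (A m <= t.+1 <= 2 * A m)%N by lia.
have : ~~ ok t.+1 by apply/negP => /tmax; rewrite ltnn.
rewrite /ok t1 /= -ltNge => /ltW; apply: le_trans.
have A0 k : (0 < A k)%N by rewrite (leq_trans _ (A2 k)) ?expn_gt0.
apply: (@total_sum_bump R e w _ _ m) => //.
- move=> n; rewrite splice_updateE; case: ltngtP => [nm|//|->].
    by rewrite (leq_trans (A2 n)) //; case/andP: (fwin _ nm).
  by rewrite (leq_trans (A2 m)) //; lia.
- by move=> k km; rewrite !splice_updateE km.
- by rewrite !splice_updateE ltnn eqxx.
- by rewrite !splice_updateE ltnn eqxx (leq_trans (A0 m)) //; lia.
- by rewrite !splice_updateE ltnn eqxx (leq_trans (AW m)) //; lia.
- by move=> k km; rewrite !splice_updateE; case: ltngtP km.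
- move=> n; apply: ratio => k; rewrite /in_window splice_updateE.
  case: ltngtP => [km|_|->] //; first exact: fwin.
  by rewrite leqnn andbT; lia.
Qed.

Lemma greedy_expansion (R : realType) {e : nat} (w : e.+1.-tuple nat) A
    (theta : R) :
  (0 < tnth w ord_max)%N -> ample w A ->
  total_sum R w (fun k => 2 * A k)%N <= theta <= total_sum R w A ->
  exists2 a, (forall k, in_window A a k) & partial_sum R w a @ \oo --> theta.
Proof.
move=> w0 amp h0.
have /choice[g hg] : forall mf : nat * (nat -> nat), exists t,
    reachable R w A theta mf.1 mf.2 ->
    reachable R w A theta mf.1.+1 (update mf.2 mf.1 t).
  move=> [m f]; have [r|nr] := pselect (reachable R w A theta m f); last by exists 0%N.
  by have [t ht] := reachable_step R w A theta m f w0 amp r; exists t.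
pose F m := iteri m (fun k f => update f k (g (k, f))) A.
have Freach m : reachable R w A theta m (F m).
  elim: m => [|m IH]; last exact: (hg (m, F m)).
  by split => //; exact: h0.
(* Diagonal sequence: digit [n] is final from stage [n + 1] on. *)
pose a n := F n.+1 n.
have aF m k : (k < m)%N -> F m k = a k.
  elim: m => // m IH; rewrite ltnS leq_eqVlt => /orP[/eqP -> //|km].
  by rewrite -IH //= /F /= /update ltn_eqF.
have awin k : in_window A a k by have [/(_ k (ltnSn k))] := Freach k.+1.
case: amp => A2 _ _.
have agree m g' N : (N + e <= m)%N ->
    partial_sum R w (splice m (F m) g') N = partial_sum R w a N.
  move=> Nm; apply: eq_bigr => n _; rewrite !weighted_termE; congr (_%:R^-1).
  apply: eq_bigr => j _.
  have njm : (n + j < m)%N by have := ltn_ord n; have := ltn_ord j; lia.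
  by rewrite /splice njm aF.
have pow g' m : (forall k, A k <= g' k)%N -> forall n, (2 ^ n <= splice m (F m) g' n)%N.
  move=> hg' n; rewrite (leq_trans (A2 n)) // /splice; case: ifP => // nm.
  by rewrite aF //; case/andP: (awin n).
(* At stage [N + e] all entries of the first [N] terms are fixed, so both completions share this
   partial sum with [a]. *)
have bounds N : partial_sum R w a N <= theta <= partial_sum R w a N + 2 * 2^-1 ^+ N.
  have [_ /andP[lo hi]] := Freach (N + e)%N; apply/andP; split.
    apply: le_trans lo; rewrite -(agree (N + e)%N (fun k => 2 * A k)%N) //.
    by apply: partial_sum_le_total => //; apply: pow => k; lia.
  apply: (le_trans hi); rewrite -(agree (N + e)%N A) //.
  by apply: total_le_ub => M; apply: partial_sum_tail => //; apply: pow.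
exists a => //.
apply: (@squeeze_cvgr _ _ _ _ (fun N => theta - 2 * 2^-1 ^+ N) (fun=> theta)).
- by apply: nearW => N; have := bounds N; lra.
- rewrite -[X in _ --> X]subr0 -[X in _ - X](mulr0 2).
  apply: cvgB; first exact: cvg_cst.
  apply: cvgM; first exact: cvg_cst.
  by apply: cvg_expr; rewrite ger0_norm ?invr_ge0 // invf_lt1 // ltr1n.
- exact: cvg_cst.
Qed.

Lemma exists_rational_sum (R : realType) {e : nat} (w : e.+1.-tuple nat) A :
  (0 < tnth w ord_max)%N -> ample w A ->
  exists2 a, (forall k, in_window A a k) &
    exists q : rat, partial_sum R w a @ \oo --> (ratr q : R).
Proof.
move=> w0 amp; have [A2 _ _] := amp.
have A0 k : (0 < A k)%N by rewrite (leq_trans _ (A2 k)) ?expn_gt0.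
have tpos : 0 < total_sum R w A.
  apply: (lt_le_trans _ (partial_sum_le_total R w A 1 w0 A2)).
  by rewrite /partial_sum big_ord1 weighted_termE invr_gt0 ltr0n denom_gt0.
(* Doubling every entry at least halves every term, so the interval of attainable sums is
   nondegenerate. *)
have half : total_sum R w (fun k => 2 * A k)%N <= total_sum R w A / 2.
  apply: total_le_ub => N; rewrite ler_pdivlMr //.
  apply: le_trans (partial_sum_le_total R w A N w0 A2).
  rewrite /partial_sum mulr_suml; apply: ler_sum => n _.
  have := denom_scale_last w (fun k => 2 * A k)%N A 1 1 n w0 (leqnn 1).
  move=> /(_ _ (leqnn _)); rewrite !exp1n !mul1n => h.
  rewrite !weighted_termE mulrC ler_pdivrMr ?ltr0n ?denom_gt0 // => [|k]; last by rewrite muln_gt0 A0.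
  rewrite ler_pdivlMl ?ltr0n ?denom_gt0 // mulrC -natrM ler_nat; apply: h => k; lia.
have [|q] := @rat_in_itvoo R (total_sum R w (fun k => 2 * A k)%N) (total_sum R w A).
  by apply: (le_lt_trans half); lra.
rewrite in_itv /= => /andP[/ltW lo /ltW hi].
have [|a wa ca] := greedy_expansion R w A (ratr q) w0 amp; first by rewrite lo hi.
by exists a => //; exists q.
Qed.

(** * Windows of the prescribed growth *)

Lemma cvg_linear_div_expr (R : realType) (c : R) : 1 < c ->
  (fun n => n.+1%:R / c ^+ n) @ \oo --> (0 : R).
Proof.
move=> c1; pose s := Num.sqrt c.
have c0 : 0 <= c by lra.
have s1 : 1 < s by rewrite -sqrtr1 ltr_sqrt //; lra.
have s0 : 0 < s by lra.
pose dl := s - 1; have dl0 : 0 < dl by rewrite subr_gt0.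
(* Bernoulli for [s = sqrt c] lets one factor [s ^+ n] absorb [n + 1]; the other still decays. *)
have bern n : 1 + n%:R * dl <= s ^+ n.
  elim: n => [|n IH]; first by rewrite mul0r addr0 expr0.
  rewrite exprS -natr1.
  apply: (@le_trans _ _ (s * (1 + n%:R * dl))); last by rewrite ler_pM2l.
  have -> : s = 1 + dl by rewrite /dl; ring.
  have : 0 <= n%:R * (dl * dl) by rewrite !mulr_ge0 // ltW.
  by lra.
apply: (@squeeze_cvgr _ _ _ _ (fun=> 0) (fun n => (1 + dl^-1) * s^-1 ^+ n)).
- apply: nearW => n; rewrite divr_ge0 ?exprn_ge0 //=.
  have -> : c = s * s by rewrite -expr2 sqr_sqrtr.
  rewrite exprMn ler_pdivrMr ?mulr_gt0 ?exprn_gt0 // exprVn mulrA mulfVK ?gt_eqF ?exprn_gt0 //.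
  apply: (@le_trans _ _ ((1 + dl^-1) * (1 + n%:R * dl))).
    have -> : (1 + dl^-1) * (1 + n%:R * dl) = n%:R + 1 + (n%:R * dl + dl^-1).
      by field; rewrite gt_eqF.
    by rewrite natr1 lerDl addr_ge0 ?invr_ge0 ?mulr_ge0 // ltW.
  by rewrite ler_pM2l // addr_gt0 // invr_gt0.
- exact: cvg_cst.
- rewrite -(mulr0 (1 + dl^-1)); apply: cvgM; first exact: cvg_cst.
  by apply: cvg_expr; rewrite ger0_norm ?invr_ge0 ?(ltW s0) // invf_lt1.
Qed.

Lemma natr_denom (R : realType) {d : nat} (w : d.-tuple nat) a n :
  (denom w a n)%:R = \prod_(j < d) (a (n + j)%N)%:R ^+ tnth w j :> R.
Proof. by rewrite natr_prod; apply: eq_bigr => j _; rewrite natrX. Qed.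

(* The factor [8 ^ k] forces consecutive windows apart, and a large constant
   [L] creates the slack needed in [ample]; neither changes the growth rate. *)
Definition scale (R : realType) (L : nat) (c g : R) (k : nat) : R :=
  L%:R * 8 ^+ k * expR (c ^+ k * g).

Definition window_base (R : realType) (L : nat) (c g : R) (k : nat) : nat :=
  (Num.truncn (scale R L c g k)).+1.

Lemma scale_ge (R : realType) L (c g : R) k : 0 <= c -> 0 <= g ->
  L%:R * 8 ^+ k <= scale R L c g k.
Proof.
move=> c0 g0; rewrite ler_peMr ?mulr_ge0 ?exprn_ge0 //.
by rewrite -expR0 ler_expR mulr_ge0 // exprn_ge0.
Qed.

(** One factor 2 is the width of the window, the other pays for rounding up, as the scale is at
    least 1. *)
Lemma window_scale (R : realType) L (c g : R) x k :
  (0 < L)%N -> 0 <= c -> 0 <= g -> in_window (window_base R L c g) x k ->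
  scale R L c g k < (x k)%:R <= 4 * scale R L c g k.
Proof.
move=> L0 c0 g0 /andP[lo hi].
have s1 : 1 <= scale R L c g k.
  apply: le_trans (scale_ge R L c g k c0 g0).
  by rewrite -natrX -natrM ler1n muln_gt0 L0 expn_gt0.
rewrite -(ler_nat R) in lo; rewrite -(ler_nat R) natrM in hi.
have := truncnS_gt (scale R L c g k).
have : (Num.truncn (scale R L c g k))%:R <= scale R L c g k.
  by rewrite truncn_le; lra.
by move: lo hi; rewrite /window_base -natr1; lra.
Qed.

Lemma scaleS (R : realType) L (c g : R) k :
  scale R L c g k.+1 = 8 * expR (c ^+ k * (c - 1) * g) * scale R L c g k.
Proof.
rewrite /scale (_ : c ^+ k.+1 * g = c ^+ k * (c - 1) * g + c ^+ k * g).
  by rewrite expRD exprS; ring.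
by rewrite exprS; ring.
Qed.

(* This is where the equation [P(c) = 0] enters: it says that the growth of the
   denominators from [n] to [n + 1] is exactly that of [C ^ (c ^ (n + e))]. *)
Lemma window_base_ample (R : realType) {e : nat} (w : e.+1.-tuple nat)
    (c g : R) :
  (0 < tnth w ord_max)%N -> 0 <= c -> 0 <= g ->
  (c - 1) * (\sum_(j < e.+1) (tnth w j)%:R * c ^+ j) = c ^+ e ->
  ample w (window_base R (4 * weight w * 32 ^ weight w) c g).
Proof.
move=> w0 c0 g0 hroot; set W := weight w; set L := (_ * 32 ^ W)%N.
have W0 : (0 < W)%N by rewrite /W /weight big_ord_recr /= addn_gt0 w0 orbT.
have L0 : (0 < L)%N by rewrite /L !muln_gt0 W0 expn_gt0.
have lb k : (L * 8 ^ k <= window_base R L c g k)%N.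
  rewrite -(ler_nat R) natrM natrX.
  apply: (le_trans (scale_ge R L c g k c0 g0)); exact/ltW/truncnS_gt.
split=> [n|n|x n xwin].
- apply: leq_trans (lb n); rewrite -[leqLHS]mul1n leq_mul //.
  by case: n => // n; rewrite leq_exp2r.
- apply: leq_trans (lb n); rewrite -mulnA -[leqLHS]muln1 leq_mul //.
  by rewrite muln_gt0 !expn_gt0.
have xs k : scale R L c g k < (x k)%:R <= 4 * scale R L c g k by exact: window_scale.
have s0 k : 0 <= scale R L c g k by rewrite !mulr_ge0 ?exprn_ge0 // expR_ge0.
rewrite -(ler_nat R) !natrM.
pose E j := expR (c ^+ (n + j) * (c - 1) * g).
(* Here [32 = 4 * 8]: the spread of a window times the extra growth of the scale. *)
have hD : (denom w x n.+1)%:R <=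
    32 ^+ W * expR (c ^+ (n + e) * g) * (denom w x n)%:R :> R.
  have -> : expR (c ^+ (n + e) * g) = \prod_(j < e.+1) E j ^+ tnth w j.
    rewrite exprD -hroot mulrA mulr_sumr mulr_suml expR_sum.
    apply: eq_bigr => j _; rewrite /E -expRM_natl; congr expR.
    by rewrite exprD; ring.
  rewrite !natr_denom /W /weight -prodrXr -!big_split /=; apply: ler_prod => j _.
  rewrite exprn_ge0 //= -!exprMn lerXn2r ?nnegrE ?mulr_ge0 ?expR_ge0 //.
  have /andP[_] := xs (n.+1 + j)%N; rewrite addSn scaleS -/(E j) => /le_trans; apply.
  have /andP[/ltW + _] := xs (n + j)%N; move=> h.
  have : E j * scale R L c g (n + j) <= E j * (x (n + j)%N)%:R.
    by rewrite ler_pM2l // expR_gt0.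
  by lra.
have /andP[/ltW hx _] := xs (n + e)%N.
apply: (le_trans (ler_wpM2l _ hD)); first by rewrite mulr_ge0.
rewrite !mulrA ler_wpM2r //; apply: le_trans hx; rewrite ler_wpM2r ?expR_ge0 //.
(* The constant [L] was chosen to absorb [2 * W * 32 ^ W]. *)
rewrite /L -!natrX -!natrM ler_nat.
rewrite -[leqLHS]muln1 leq_mul ?expn_gt0 //.
by rewrite !leq_mul2r !orbT.
Qed.

(** The scale grows at least 8-fold per step, beyond the spread 4. *)
Lemma window_increasing (R : realType) L (c g : R) a k :
  (0 < L)%N -> 1 <= c -> 0 <= g ->
  (forall k, in_window (window_base R L c g) a k) -> (a k < a k.+1)%N.
Proof.
move=> L0 c1 g0 awin; have c0 : 0 <= c by lra.
have /andP[_ h1] := window_scale R L c g a k L0 c0 g0 (awin k).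
have /andP[h2 _] := window_scale R L c g a k.+1 L0 c0 g0 (awin k.+1).
rewrite -(ltr_nat R); apply: le_lt_trans h1 _; apply: le_lt_trans h2.
rewrite scaleS ler_wpM2r ?mulr_ge0 ?exprn_ge0 ?expR_ge0 //.
have : 1 <= expR (c ^+ k * (c - 1) * g).
  by rewrite -[leLHS]expR0 ler_expR !mulr_ge0 ?exprn_ge0 ?subr_ge0.
by lra.
Qed.

(** After taking logarithms, [L], [8 ^ n] and the spread contribute only [O(n)], negligible against
    [c ^ n]. *)
Lemma window_growth (R : realType) L (c g : R) a :
  (0 < L)%N -> 1 < c -> 0 <= g ->
  (forall k, in_window (window_base R L c g) a k) ->
  (fun n => (a n)%:R `^ (1 / c ^+ n)) @ \oo --> expR g.
Proof.
move=> L0 c1 g0 awin; have c0 : 0 <= c by lra.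
have cn0 n : 0 < c ^+ n by rewrite exprn_gt0 //; lra.
have Lp : 0 < L%:R :> R by rewrite ltr0n.
have s0 n : 0 < scale R L c g n by rewrite !mulr_gt0 ?exprn_gt0 ?expR_gt0.
have aw n := window_scale R L c g a n L0 c0 g0 (awin n).
have a0 n : 0 < (a n)%:R :> R by have /andP[h _] := aw n; exact: lt_trans h.
have lns n : ln (scale R L c g n) = ln L%:R + ln 8 *+ n + c ^+ n * g.
  by rewrite !lnM ?posrE ?mulr_gt0 ?exprn_gt0 ?expR_gt0 // lnXn // expRK.
pose K : R := ln 4 + ln L%:R + ln 8.
have l8 : 0 <= ln 8 :> R by rewrite ln_ge0 // ler1n.
have l4 : 0 <= ln 4 :> R by rewrite ln_ge0 // ler1n.
have lL : 0 <= ln L%:R :> R by rewrite ln_ge0 // ler1n.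
have -> : (fun n => (a n)%:R `^ (1 / c ^+ n)) =
          expR \o (fun n => ln (a n)%:R / c ^+ n).
  by apply/funext => n; rewrite /powR gt_eqF // div1r mulrC.
apply: continuous_cvg; first exact: continuous_expR.
apply: (@squeeze_cvgr _ _ _ _ (fun=> g) (fun n => g + K * (n.+1%:R / c ^+ n))).
- apply: nearW => n; have /andP[lo hi] := aw n.
  have {}lo : ln (scale R L c g n) <= ln (a n)%:R by rewrite ler_ln ?posrE // ltW.
  have {}hi : ln (a n)%:R <= ln 4 + ln (scale R L c g n).
    by rewrite -lnM ?posrE // ler_ln ?posrE ?mulr_gt0 ?expR_gt0.
  have n8 : 0 <= ln 8 *+ n :> R by rewrite mulrn_wge0.
  rewrite lns in lo hi; rewrite ler_pdivlMr // ler_pdivrMr //; apply/andP; split.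
    by rewrite mulrC; lra.
  rewrite mulrDl mulrA divfK ?gt_eqF // -natr1 /K.
  have hn : 0 <= (ln 4 + ln L%:R) * n%:R :> R by rewrite mulr_ge0 // addr_ge0.
  rewrite -(mulr_natr (ln 8) n) in hi; move: hi hn l8; rewrite [c ^+ n * g]mulrC; lra.
- exact: cvg_cst.
- rewrite -[X in _ --> X]addr0 -[X in _ + X](mulr0 K).
  apply: cvgD; first exact: cvg_cst.
  by apply: cvgM; [exact: cvg_cst | exact: cvg_linear_div_expr].
Qed.

Theorem theorem3 (R : realType) (d : nat) (w : d.-tuple nat) (c : R)
    (hd : (0 < d)%N) (hw : (1 <= nth 0%N w d.-1)%N)
    (hc : is_largest_positive_root (Ptilde R w) c) (C : R) (hC : 1 < C) :
  exists a : nat -> nat,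
    [/\ forall n, (1 <= n)%N -> (0 < a n)%N,
        forall n, (1 <= n)%N -> (a n < a n.+1)%N,
        (fun n : nat => (a n)%:R `^ (1 / c ^+ n) : R) @ \oo --> C
      & exists q : rat,
          (fun N : nat => \sum_(1 <= n < N) weighted_term R w a n) @ \oo
            --> (ratr q : R)].
Proof.
have c1 : 1 < c.
  have [c' [rc' c'0 _] c'1] := Ptilde_largest_positive_root_exists R hd hw.
  by have [_ _ cmax] := hc; exact: lt_le_trans c'1 (cmax _ rc' c'0).
case: d w hd hw hc => // e w _ hw [rc _ _].
have w0 : (0 < tnth w ord_max)%N by rewrite (tnth_nth 0%N).
have hroot : (c - 1) * (\sum_(j < e.+1) (tnth w j)%:R * c ^+ j) = c ^+ e.
  move: rc; rewrite rootE /Ptilde !hornerE horner_sum subr_eq0 => /eqP <-.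
  by congr (_ * _); apply: eq_bigr => j _; rewrite !hornerE.
have g0 : 0 < ln C by rewrite ln_gt0.
have c0 : 0 <= c by lra.
have amp := window_base_ample R w c (ln C) w0 c0 (ltW g0) hroot.
have L0 : (0 < 4 * weight w * 32 ^ weight w)%N.
  by rewrite !muln_gt0 expn_gt0 /weight big_ord_recr /= addn_gt0 w0 orbT.
have [a awin [q aq]] := exists_rational_sum R w _ w0 amp.
have a0 n : (0 < a n)%N by have /andP[+ _] := awin n; apply: leq_trans.
exists a; split=> // [n _||].
- exact: window_increasing L0 (ltW c1) (ltW g0) awin.
- by rewrite -[C]lnK ?posrE; [exact: window_growth L0 c1 (ltW g0) awin | lra].
(* The required series starts at index 1, so the rational term at index 0 is removed. *)
exists (q - (denom w a 0)%:R^-1).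
rewrite rmorphB /= fmorphV /= ratr_nat -weighted_termE.
rewrite -cvg_shiftS /=.
have -> : (fun N => \sum_(1 <= n < N.+1) weighted_term R w a n) =
          (fun N => partial_sum R w a N.+1 - weighted_term R w a 0).
  apply/funext => N; rewrite /partial_sum big_ord_recl /= addrC addKr.
  by rewrite big_add1 /= big_mkord.
by apply: cvgB; [rewrite cvg_shiftS | exact: cvg_cst].
Qed.
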